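(* Let $m,n\ge 1$, let $\mathbf{S}=\{A_1,\dots,A_m\}\subset \mathbb{S}^n$ be real symmetric $n\times n$ matrices, and let $b\in\mathbb{R}^m$. The following two conditions are equivalent: (1) $b\in SH(\mathbf{S})$. (2) For each $X'\in\mathbf{\Delta}_n$ there exists $V\in\mathbf{\Delta}_n$ such that $\Vert p(X')-p(V)\Vert\ge \Vert b-p(V)\Vert$. Equivalently, the following two conditions are equivalent: (1') $b\notin SH(\mathbf{S})$. (2') There exists $W\in\mathbf{\Delta}_n$ such that $\Vert p(W)-p(X)\Vert<\Vert b-p(X)\Vert$ for all $X\in\mathbf{\Delta}_n$.
   Context: $\mathbb{S}^n$ is the space of real symmetric $n\times n$ matrices with inner product $X\bullet Y=\mathrm{Tr}(XY)$. $X\succeq 0$ means $X\in\mathbb{S}^n$ is positive semidefinite. The spectraplex is $\mathbf{\Delta}_n=\{X\in\mathbb{S}^n: \mathrm{Tr}(X)=1,\ X\succeq 0\}$. Given $\mathbf{S}=\{A_1,\dots,A_m\}\subset\mathbb{S}^n$, define $p(X)=(A_1\bullet X,\dots,A_m\bullet X)^T\in\mathbb{R}^m$ for $X\in\mathbf{\Delta}_n$; the spectrahull of $\mathbf{S}$ is $SH(\mathbf{S})=\{p(X): X\in\mathbf{\Delta}_n\}\subset\mathbb{R}^m$. $\Vert\cdot\Vert$ on $\mathbb{R}^m$ is the Euclidean norm. *)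

(* Defs.v *)
From mathcomp Require Import all_boot all_order all_algebra sesquilinear.
From mathcomp Require Import boolp classical_sets reals.

Set Implicit Arguments.
Unset Strict Implicit.
Unset Printing Implicit Defensive.

Import Order.TTheory GRing.Theory Num.Theory.
Local Open Scope ring_scope.
Local Open Scope classical_set_scope.

Definition mxinner (R : realType) (n : nat) (X Y : 'M[R]_n) : R := \tr (X *m Y).

(* Over R, nonnegativity of the quadratic form does not entail symmetry, hence
   the first conjunct. *)
Definition psdmx (R : realType) (n : nat) (X : 'M[R]_n) : Prop :=
  X \is symmetricmx /\ forall x : 'cV[R]_n, 0 <= (x^T *m X *m x) 0 0.

Definition spectraplex (R : realType) (n : nat) : set 'M[R]_n :=
  [set X | \tr X = 1 /\ psdmx X].
Arguments spectraplex : clear implicits.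

Definition trace_map (R : realType) (m n : nat) (A : 'I_m -> 'M[R]_n) (X : 'M[R]_n) :
  'cV[R]_m := \col_i mxinner (A i) X.

Definition spectrahull (R : realType) (m n : nat) (A : 'I_m -> 'M[R]_n) :
  set 'cV[R]_m := [set trace_map A X | X in spectraplex R n].

(* The library norm on matrices is the sup norm, not the Euclidean one. *)
Definition enorm (R : realType) (m : nat) (x : 'cV[R]_m) : R :=
  Num.sqrt (\sum_i x i 0 ^+ 2).

(* Main.v *)
(* Let p(W) be the point of the spectrahull nearest to b; it exists because the
   spectraplex is compact.  By convexity, <b - p(W), p(X) - p(W)> <= 0 for every
   X in the spectraplex, so if b <> p(W) then
   |b - p(X)|^2 >= |b - p(W)|^2 + |p(W) - p(X)|^2 > |p(W) - p(X)|^2. *)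
From HB Require Import structures.
Require Import Defs.
From mathcomp Require Import all_boot all_order all_algebra sesquilinear.
From mathcomp Require Import boolp classical_sets reals.
From mathcomp Require Import topology normedtype derive ring lra.

Set Implicit Arguments.
Unset Strict Implicit.
Unset Printing Implicit Defensive.

Import Order.TTheory GRing.Theory Num.Theory.
Import numFieldNormedType.Exports.
Local Open Scope ring_scope.
Local Open Scope classical_set_scope.

Lemma symmetricmxP (R : fieldType) (n : nat) (X : 'M[R]_n) :
  reflect (forall i j, X i j = X j i) (X \is symmetricmx).
Proof.
apply: (iffP idP) => [/is_hermitianmxP|] H.
  by move=> i j; rewrite {1}H expr0 scale1r !mxE.
apply/is_hermitianmxP; apply/matrixP => i j.
by rewrite expr0 scale1r !mxE H.
Qed.

(** In finite dimension a linear form is a finite combination of the coordinate functions, each of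
    which is continuous. *)
Lemma rV_scalar_continuous (R : realType) (k : nat) (g : 'rV[R]_k -> R) :
  scalar g -> continuous g.
Proof.
move=> gl.
(* [scalar g] is only a proposition; [G] bundles it with [g] so that the rewriting rules for linear
   maps apply. *)
pose G := HB.pack_for {scalar 'rV[R]_k} g (GRing.isLinear.Build _ _ _ _ _ gl).
have -> : g = (fun v => \sum_j v 0 j * g (delta_mx 0 j)).
  apply/funext => v; rewrite {1}[v]row_sum_delta.
  rewrite -[g]/(G : _ -> _) linear_sum.
  by apply: eq_bigr => j _; rewrite linearZ.
apply: continuous_big => [|j _ x]; first exact: add_continuous.
apply: (@continuousM _ _ (fun v : 'rV[R]_k => v 0 j)); last exact: cst_continuous.
exact: (@coord_continuous R 1 k 0 j x).
Qed.

Lemma closed_scalar_preimage (R : realType) (k : nat) (g : 'rV[R]_k -> R)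
    (D : set R) :
  scalar g -> closed D -> closed (g @^-1` D).
Proof.
move=> gl; apply: preimage_closed => v _.
exact: rV_scalar_continuous.
Qed.

Section spectraplex_theory.
Variables (R : realType) (n : nat).
Implicit Types X Y : 'M[R]_n.

(** The quadratic form of [u *m u^T] at [x] is the square of the inner product of [u] and [x]. *)
Lemma rank1_spectraplex (u : 'cV[R]_n) :
  \tr (u *m u^T) = 1 -> spectraplex R n (u *m u^T).
Proof.
move=> tru; split => //; split.
  apply/symmetricmxP => i j; rewrite !mxE.
  by apply: eq_bigr => k _; rewrite !mxE mulrC.
move=> x; rewrite mulmxA -mulmxA.
have -> : u^T *m x = (x^T *m u)^T by rewrite trmx_mul trmxK.
rewrite mxE sumr_ge0// => i _.
by rewrite [X in _ * X]mxE -expr2 sqr_ge0.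
Qed.

Lemma spectraplex_neq0 : (1 <= n)%N -> spectraplex R n !=set0.
Proof.
move=> n1; pose e : 'cV[R]_n := delta_mx (Ordinal n1) 0.
exists (e *m e^T); apply: rank1_spectraplex.
by rewrite mxtrace_mulC trmx_delta mul_delta_mx trace_mx11 mxE !eqxx.
Qed.

Lemma spectraplex_convex X Y (t : R) : 0 <= t <= 1 ->
  spectraplex R n X -> spectraplex R n Y -> spectraplex R n (X + t *: (Y - X)).
Proof.
move=> /andP[t0 t1] [trX [sX pX]] [trY [sY pY]]; split; last split.
- by rewrite linearD linearZ linearB /= trX trY subrr mulr0 addr0.
- apply/symmetricmxP => i j; rewrite !mxE.
  by rewrite (symmetricmxP _ sX i j) (symmetricmxP _ sY i j).
- move=> x; rewrite mulmxDr mulmxDl -scalemxAr -scalemxAl mulmxBr mulmxBl !mxE.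
  have := pX x; have := pY x; rewrite !mxE; nra.
Qed.

(** Boundedness, for compactness. Testing the form on $e_i \pm e_j$ gives $2|X_{ij}| \le X_{ii} +
    X_{jj}$, and the diagonal entries are nonnegative with sum 1. *)
Lemma spectraplex_le1 X i j : spectraplex R n X -> `|X i j| <= 1.
Proof.
move=> [trX [/symmetricmxP sX pX]].
have quadE (a c : R) :
    0 <= a ^+ 2 * X i i + a * c * X i j *+ 2 + c ^+ 2 * X j j.
  have := pX (a *: delta_mx i 0 + c *: delta_mx j 0).
  have -> : (a *: delta_mx i 0 + c *: delta_mx j 0 : 'cV[R]_n)^T =
            a *: delta_mx 0 i + c *: delta_mx 0 j.
    by rewrite linearD !linearZ /= !trmx_delta.
  rewrite !mulmxDl !mulmxDr -!scalemxAl -!rowE -!scalemxAr -!colE.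
  rewrite !mxE (sX j i).
  lra.
have diag_ge0 k : 0 <= X k k.
  by have := pX (delta_mx k 0); rewrite trmx_delta -rowE -colE !mxE.
have diag_le1 k : X k k <= 1.
  by rewrite -trX /mxtrace (bigD1 k)//= lerDl sumr_ge0.
have := quadE 1 1; have := quadE 1 (-1); have := diag_le1 i; have := diag_le1 j.
rewrite ler_norml; lra.
Qed.

(** A closed subset of the cube $[-1,1]^{n^2}$ is compact; matrices are flattened to row vectors so
    that the cube is a product of segments. *)
Lemma spectraplex_compact :
  compact [set v : 'rV[R]_(n * n) | spectraplex R n (vec_mx v)].
Proof.
pose box (_ : 'I_(n * n)) : set R := `[-1, 1]%classic.
have boxc i : compact (box i) by exact: segment_compact.
apply: subclosed_compact (rV_compact boxc) _; last first.
  move=> v /= vS i; rewrite /box /= in_itv /= -ler_norml.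
  case/mxvec_indexP: i => i j.
  by have := spectraplex_le1 i j vS; rewrite mxE.
(* Each condition becomes a closed condition on a linear form in [v]: the trace, a difference of
   mirrored entries, or the quadratic form at a fixed [x]. *)
have -> : [set v : 'rV[R]_(n * n) | spectraplex R n (vec_mx v)] =
    [set v | \tr (vec_mx v) = 1] `&`
    (\bigcap_ij [set v | vec_mx v ij.1 ij.2 - vec_mx v ij.2 ij.1 = 0] `&`
     \bigcap_(x : 'cV[R]_n) [set v | 0 <= (x^T *m vec_mx v *m x) 0 0]).
  apply/seteqP; split => v /=.
    move=> [trv [/symmetricmxP sv pv]]; split=> //; split=> [[i j] _|x _] /=.
      by rewrite sv subrr.
    exact: pv.
  move=> [trv [sv pv]]; split => //; split => [|x]; last exact: pv.
  apply/symmetricmxP => i j; apply/eqP; rewrite -subr_eq0; apply/eqP.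
  exact: (sv (i, j)).
apply: closedI; last apply: closedI.
- apply: (closed_scalar_preimage (g := fun v => \tr (vec_mx v))) (@closed_eq _ 1).
  by move=> a u w; rewrite !linearP.
- apply: closed_bigI => -[i j] _.
  pose g (v : 'rV[R]_(n * n)) := vec_mx v i j - vec_mx v j i.
  apply: (closed_scalar_preimage (g := g)) (@closed_eq _ 0) => a u w.
  by rewrite /g !mxE /=; ring.
- apply: closed_bigI => x _.
  pose g (v : 'rV[R]_(n * n)) := (x^T *m vec_mx v *m x) 0 0.
  apply: (closed_scalar_preimage (g := g)) (@closed_ge _ 0) => a u w.
  by rewrite /g linearP /= mulmxDr mulmxDl -scalemxAr -scalemxAl !mxE.
Qed.

End spectraplex_theory.

Section trace_map_theory.
Variables (R : realType) (m n : nat) (A : 'I_m -> 'M[R]_n).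

Lemma trace_mapDZ (t : R) X Y :
  trace_map A (X + t *: Y) = trace_map A X + t *: trace_map A Y.
Proof.
apply/matrixP => i j; rewrite !mxE /mxinner.
by rewrite mulmxDr mxtraceD -scalemxAr mxtraceZ.
Qed.

Lemma trace_mapB X Y : trace_map A (X - Y) = trace_map A X - trace_map A Y.
Proof. by rewrite -scaleN1r trace_mapDZ scaleN1r. Qed.

(** A continuous function attains its minimum on a nonempty compact set. The squared distance is
    used, being polynomial in the entries. *)
Lemma nearest_trace_map (b : 'cV[R]_m) : (1 <= n)%N ->
  exists W, spectraplex R n W /\ forall X, spectraplex R n X ->
    \sum_i (b - trace_map A W) i 0 ^+ 2 <= \sum_i (b - trace_map A X) i 0 ^+ 2.
Proof.
move=> n1.
pose f (v : 'rV[R]_(n * n)) := \sum_i (b - trace_map A (vec_mx v)) i 0 ^+ 2.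
have fc : continuous f.
  apply: continuous_big => [|i _ v]; first exact: add_continuous.
  suff cc : {for v, continuous (fun v => (b - trace_map A (vec_mx v)) i 0)}.
    exact: (@continuousM _ _ _ _ _ cc cc).
  have -> : (fun v => (b - trace_map A (vec_mx v)) i 0) =
            (fun v => b i 0 - \tr (A i *m vec_mx v)).
    by apply/funext => w; rewrite !mxE.
  apply: continuousB; first exact: cst_continuous.
  apply: rV_scalar_continuous => a u w.
  by rewrite linearP /= mulmxDr -scalemxAr linearP.
have [X0 X0S] := spectraplex_neq0 R n1.
have S0 : [set v : 'rV[R]_(n * n) | spectraplex R n (vec_mx v)] !=set0.
  by exists (mxvec X0); rewrite /= mxvecK.
have [w /set_mem wS wmin] := compact_EVT_min S0 (@spectraplex_compact R n)
   (continuous_subspaceT fc).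
exists (vec_mx w); split => // X XS.
have := wmin (mxvec X); rewrite /f mxvecK; apply.
by rewrite inE /= mxvecK.
Qed.

End trace_map_theory.

(** First-order optimality: after division by [t], letting [t] tend to 0 leaves [s <= 0]. The proof
    uses a single explicit [t] instead of a limit. *)
Lemma le0_of_quadratic (R : realFieldType) (s q : R) : 0 <= q ->
  (forall t, 0 <= t <= 1 -> 2 * t * s <= t ^+ 2 * q) -> s <= 0.
Proof.
move=> q0 H; rewrite leNgt; apply/negP => s0.
have sq0 : 0 < s + q by lra.
have : 0 <= s / (s + q) <= 1.
  by rewrite divr_ge0 ?(ltW s0) ?(ltW sq0)//= ler_pdivrMr// mul1r; lra.
(* With this [t], $tq = s - ts < s$, whereas the hypothesis divided by [t] gives $2s \le tq$. *)
move=> /H; set t := s / (s + q).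
have tE : t * (s + q) = s by rewrite divfK// gt_eqF.
have t0 : 0 < t by rewrite divr_gt0.
nra.
Qed.

Lemma enorm_ge0 (R : realType) (m : nat) (x : 'cV[R]_m) : 0 <= enorm x.
Proof. exact: sqrtr_ge0. Qed.

Lemma enorm0 (R : realType) (m : nat) : enorm (0 : 'cV[R]_m) = 0.
Proof. by rewrite /enorm big1 ?sqrtr0// => i _; rewrite mxE expr0n. Qed.

Lemma sum_sqrB (R : comPzRingType) (m : nat) (c u : 'cV[R]_m) :
  \sum_i (c - u) i 0 ^+ 2 =
  \sum_i c i 0 ^+ 2 - (\sum_i c i 0 * u i 0) *+ 2 + \sum_i u i 0 ^+ 2.
Proof.
rewrite -sumrMnl -sumrB -big_split /=; apply: eq_bigr => i _.
by rewrite !mxE sqrrB.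
Qed.

Theorem theorem8 (R : realType) (m n : nat) (hm : (1 <= m)%N) (hn : (1 <= n)%N)
    (A : 'I_m -> 'M[R]_n) (hA : forall i, A i \is symmetricmx) (b : 'cV[R]_m) :
  (spectrahull A b <->
   forall X', spectraplex R n X' ->
     exists V, spectraplex R n V /\
       enorm (trace_map A X' - trace_map A V) >= enorm (b - trace_map A V))
  /\
  (~ spectrahull A b <->
   exists W, spectraplex R n W /\
     forall X, spectraplex R n X ->
       enorm (trace_map A W - trace_map A X) < enorm (b - trace_map A X)).
Proof.
(* This is (1') implies (2'); it is isolated because (2) implies (1) also rests on it. *)
have sepW : ~ spectrahull A b -> exists W, spectraplex R n W /\
     forall X, spectraplex R n X ->
       enorm (trace_map A W - trace_map A X) < enorm (b - trace_map A X).
  move=> bS; have [W [WS Wmin]] := nearest_trace_map A b hn.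
  exists W; split => // X XS.
  set c := b - trace_map A W; set u := trace_map A X - trace_map A W.
  have sqr_sum_ge0 (x : 'cV[R]_m) : 0 <= \sum_i x i 0 ^+ 2.
    by apply: sumr_ge0 => i _; exact: sqr_ge0.
  (* If [c] were zero, [b] would be the image of [W], hence in the spectrahull. *)
  have c_gt0 : 0 < \sum_i c i 0 ^+ 2.
    rewrite lt_def sqr_sum_ge0 andbT; apply/eqP => c0; apply: bS.
    exists W => //; apply/esym/subr0_eq/matrixP => i j.
    rewrite (ord1 j) [RHS]mxE; apply/eqP; rewrite -sqrf_eq0; apply/eqP.
    by apply: (psumr_eq0P _ c0) => // k _; exact: sqr_ge0.
  (* Minimality of [W] against $W + t(X - W)$ reads $|c|^2 \le |c - tu|^2$, that is $2t\langle
     c,u\rangle \le t^2|u|^2$. *)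
  have cu_le0 : \sum_i c i 0 * u i 0 <= 0.
    apply: (le0_of_quadratic (sqr_sum_ge0 u)) => t t01.
    have := Wmin _ (spectraplex_convex t01 WS XS).
    rewrite trace_mapDZ trace_mapB opprD addrA -/c -/u (sum_sqrB c).
    have -> : \sum_i c i 0 * (t *: u) i 0 = t * \sum_i c i 0 * u i 0.
      by rewrite mulr_sumr; apply: eq_bigr => i _; rewrite !mxE mulrCA.
    have -> : \sum_i (t *: u) i 0 ^+ 2 = t ^+ 2 * \sum_i u i 0 ^+ 2.
      by rewrite mulr_sumr; apply: eq_bigr => i _; rewrite !mxE exprMn.
    lra.
  have -> : b - trace_map A X = c - u by rewrite /c /u opprB addrA subrK.
  have -> : trace_map A W - trace_map A X = - u by rewrite opprB.
  rewrite /enorm (sum_sqrB c).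
  have -> : \sum_i (- u) i 0 ^+ 2 = \sum_i u i 0 ^+ 2.
    by apply: eq_bigr => i _; rewrite mxE sqrrN.
  (* It remains that $|u|^2 < |c|^2 - 2\langle c,u\rangle + |u|^2$; [ltr_sqrt] also asks that the
     right side be positive. *)
  have u_ge0 := sqr_sum_ge0 u; rewrite ltr_sqrt; lra.
split; split => //.
(* A preimage [V] of [b] works for every [X'], its distance to [b] being 0. *)
- move=> [V VS <-] X' _; exists V; split => //.
  by rewrite subrr enorm0 enorm_ge0.
- move=> H; apply: contrapT => nS; have [W [WS Wlt]] := sepW nS.
  by have [V [VS]] := H _ WS; rewrite leNgt Wlt.
(* At a preimage [X] of [b], the strict inequality would put a norm below 0. *)
- move=> [W [WS Wlt]] [X XS pX]; have := Wlt _ XS.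
  by rewrite pX subrr enorm0 ltNge enorm_ge0.
Qed.
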